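(* For every $\epsilon > 0$ there exists a constant $C_{\epsilon} > 0$ (depending only on $\epsilon$) such that for every integer $N \geq 1$, $$\left( \int_0^1 \Big( \sup_{0<t<1} \Big| \sum_{n=1}^{N} e^{2\pi i (nx + n^2 t)} \Big| \Big)^4 \, dx \right)^{1/4} \leq C_{\epsilon} N^{3/4+\epsilon}.$$ *)

(* Defs.v *)
From mathcomp Require Import all_boot all_order all_algebra.
From mathcomp Require Import all_classical all_reals all_analysis.
From mathcomp Require Import complex.

Set Implicit Arguments.
Unset Strict Implicit.
Unset Printing Implicit Defensive.

Import GRing.Theory Num.Theory.

Local Open Scope ring_scope.
Local Open Scope complex_scope.

(* e^{i theta}, by Euler's formula. *)
Definition expi (R : realType) (theta : R) : R[i] := cos theta +i* sin theta.

Definition weyl_sum (R : realType) (N : nat) (x t : R) : R[i] :=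
  \sum_(1 <= n < N.+1) expi (2 * pi * (n%:R * x + n%:R ^+ 2 * t)).

(* The supremum is taken in \bar R, so it needs no boundedness side condition.
   [Normc.normc] is the R-valued modulus; the generic [`|z|] on [R[i]]
   is complex-valued. *)
Definition weyl_maximal (R : realType) (N : nat) (x : R) : \bar R :=
  ereal_sup [set (Normc.normc (weyl_sum N x t))%:E | t in `]0, 1[%classic].

(* Main.v *)
Require Import Defs.
From mathcomp Require Import all_boot all_order all_algebra.
From mathcomp Require Import all_classical all_reals all_analysis.
From mathcomp Require Import measurable_realfun complex ring lra zify.

(** Write [S(x, t)] for the Weyl sum, [e(u)] for [exp(2 pi i u)] and [L] for
    [1 + ln N].

    The point is that a large value of [S(x, t)] constrains [x] alone, whatever
    [t] is. By [large_value], if [|S(x, t)| >= V] with [V^2] at least [2^10 L N],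
    then for some [q <= 8 N^2 / V^2] the number [2 q x] is within [2^13 L N / V^2]
    of an integer. For each [q] this leaves [O(q)] arcs of length
    [O(L N / (q V^2))], so the set of all such [x] has measure [O(L N^3 / V^4)]:
    a weak-type bound at exponent 4 for the maximal function. Summing over the
    heights [V = N / 2^j] costs one more logarithm, and the values below the
    threshold contribute only [O(L^2 N^2)]. Hence the fourth power of the maximal
    function has integral [O(L^2 N^3)] ([majorant_integral_bound]), and [L^2] is
    [O(N^(4 eps))].

    For [large_value], square the sum. This gives a sum over shifts [h] and
    indices [n] of the terms [e(h x + 2 n h t - h^2 t)] ([weyl_sum_sqr_le]).
    Approximate [2 t] by a fraction [a / q] with [q <= M], where [M] is about
    [V^2 / (64 L)], and with error at most [1 / (q M)]. If [q] does not divide [h],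
    the sum over [n] is geometric with ratio away from 1; these shifts contribute
    [O((N + M) L)], too little to make up [V^2] ([nonmultiple_le]). So the shifts
    [h = k q] must contribute a multiple of [V^2]. Trivially they give at most
    [N (N / q + 1)], which bounds [q]. On the other hand, for fixed [n] the sum
    over [k] has a nearly constant frequency [y = q x - q a / 2] modulo 1, and a
    Kusmin-Landau estimate bounds it by [6 / |e(y) - 1|] ([multiple_le]); so
    [|e(y) - 1|] is [O(L N / V^2)], and doubling [y] turns [q a / 2] into an
    integer. The square-root cancellation of Gauss sums never has to be proved: it
    is contained in the squaring. *)

Set Implicit Arguments.
Unset Strict Implicit.
Unset Printing Implicit Defensive.

Import Order.TTheory GRing.Theory Num.Theory.
Import numFieldNormedType.Exports.
Import Normc.

Local Open Scope ring_scope.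

(** * The circle and its chord distance *)

Section CircleDistance.
Variable R : realType.
Implicit Types (x y u v : R).

Lemma normc_ge0 (z : R[i]) : 0 <= normc z.
Proof. by case: z => a b; exact: sqrtr_ge0. Qed.

Definition ee x : R[i] := expi (2 * pi * x).

Lemma eeD x y : ee (x + y) = ee x * ee y.
Proof. by rewrite /ee /expi mulrDr cosD sinD; simpc; rewrite [_ * sin _ + _ in RHS]addrC. Qed.

Lemma normc_ee x : normc (ee x) = 1.
Proof. by rewrite /normc /ee /expi /= cos2Dsin2 sqrtr1. Qed.

Lemma ee0 : ee 0 = 1.
Proof. by rewrite /ee /expi mulr0 cos0 sin0 complexr0. Qed.

Lemma ee_nat n : ee n%:R = 1.
Proof.
elim: n => [|n IH]; first exact: ee0.
by rewrite -natr1 eeD IH mul1r /ee /expi mulr1 mulr_natl cos2pi sin2pi complexr0.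
Qed.

Lemma eeNK x : ee (- x) * ee x = 1.
Proof. by rewrite -eeD addNr ee0. Qed.

Lemma ee_int (m : int) : ee m%:~R = 1.
Proof.
case: m => n; first exact: ee_nat.
by rewrite NegzE mulrNz -[LHS]mulr1 -[X in _ * X](ee_nat n.+1) eeNK.
Qed.

Lemma conjc_ee x : ((ee x)^* )%C = ee (- x).
Proof. by rewrite /ee /expi mulrN cosN sinN. Qed.

(** The chord length stands in for the distance to the nearest integer: the two
    are comparable ([cdist_le], [cdist_ge]), while the chord is exactly
    subadditive and invariant under integer shifts, with no rounding. *)
Definition cdist x := normc (ee x - 1).

Lemma cdist_ge0 x : 0 <= cdist x.
Proof. exact: normc_ge0. Qed.

Lemma cdistN x : cdist (- x) = cdist x.
Proof.
rewrite /cdist -[RHS]mul1r -(normc_ee (- x)) -normcM mulrBr eeNK mulr1.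
by rewrite -normcN opprB.
Qed.

Lemma cdistDint x (m : int) : cdist (x + m%:~R) = cdist x.
Proof. by rewrite /cdist eeD ee_int mulr1. Qed.

Lemma cdistD x y : cdist (x + y) <= cdist x + cdist y.
Proof.
have -> : cdist (x + y) = normc (ee y * (ee x - 1) + (ee y - 1)).
  by rewrite /cdist eeD; congr normc; ring.
by apply: le_trans (le_normcD _ _) _; rewrite normcM normc_ee mul1r.
Qed.

Lemma cdistB_ge x y : cdist x - cdist y <= cdist (x - y).
Proof. by rewrite lerBlDr; apply: le_trans (cdistD _ _); rewrite subrK. Qed.

Lemma cdistE x : cdist x = 2 * `|sin (pi * x)|.
Proof.
rewrite /cdist /ee /expi /normc.
have -> : 2 * pi * x = (pi * x) *+ 2 by rewrite -mulrA mulr_natl.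
rewrite cos_mulr2n sin_mulr2n /= subr0.
set c := cos _; set s := sin _.
have h : c ^+ 2 = 1 - s ^+ 2 by rewrite cos2sin2.
have -> : (c ^+ 2 *+ 2 - 1 - 1) ^+ 2 + (c * s *+ 2) ^+ 2 = (2 * s) ^+ 2.
  have -> : (c * s *+ 2) ^+ 2 = 4 * c ^+ 2 * s ^+ 2 by ring.
  by rewrite h; ring.
by rewrite sqrtr_sqr normrM ger0_norm.
Qed.

Lemma sin_MVT v : 0 <= v -> exists2 c, 0 <= c <= v & sin v = cos c * v.
Proof.
move=> v0.
have [|c] := @MVT_segment R sin cos 0 v v0.
  by apply: continuous_subspaceT => z; exact: continuous_sin.
by rewrite sin0 !subr0 => cin ->; exists c => //; move: cin; rewrite in_itv.
Qed.

Lemma norm_sin_le v : `|sin v| <= `|v|.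
Proof.
wlog v0 : v / 0 <= v => [H|].
  have [/H//|/ltW v0] := leP 0 v.
  by have := H (- v); rewrite sinN !normrN oppr_ge0; exact.
have [c _ ->] := sin_MVT v0.
by rewrite normrM ler_piMl // cos_max.
Qed.

Lemma cos_sqr_ge_half v : 0 <= v <= pi / 4 -> 0 <= cos v /\ 1 / 2 <= cos v ^+ 2.
Proof.
move=> /andP[v0 v4]; have pi0 := pi_gt0 R.
split; first by apply: cos_ge0_pihalf; lra.
have : 0 <= cos (v *+ 2) by apply: cos_ge0_pihalf; lra.
by rewrite cos_mulr2n; lra.
Qed.

(** Halving the angle brings it below [pi / 4], where the squared cosine is at
    least one half: [sin (2 w) = 2 cos w sin w = 2 w cos w cos c]. *)
Lemma sin_ge_half v : 0 <= v <= pi / 2 -> v / 2 <= sin v.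
Proof.
move=> /andP[v0 v2]; have pi0 := pi_gt0 R.
have [w vE] : exists w, v = w *+ 2 by exists (v / 2); rewrite -mulr_natr; lra.
rewrite {v}vE in v0 v2 *.
have [|c /andP[c0 cv] e] := @sin_MVT w; first lra.
rewrite sin_mulr2n e.
have [|a1 a1s] := @cos_sqr_ge_half w; first lra.
have [|a2 a2s] := @cos_sqr_ge_half c; first lra.
have a3 : 1 / 2 <= cos w * cos c.
  rewrite -ler_sqr ?nnegrE ?mulr_ge0 //.
  have h : 0 <= 1 / 2 :> R by lra.
  have := ler_pM h h a1s a2s.
  by rewrite exprMn; lra.
have w0 : 0 <= w by lra.
have := ler_wpM2r w0 a3.
by rewrite !mulr2n mulrA; lra.
Qed.

Lemma pi_le4 : pi <= 4 :> R.
Proof. by have := pihalf_lt2 R; lra. Qed.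

Lemma cdist_le x : cdist x <= 8 * `|x|.
Proof.
rewrite cdistE; have := norm_sin_le (pi * x).
rewrite normrM (ger0_norm (pi_ge0 R)).
by have := pi_le4; have := normr_ge0 x; nra.
Qed.

Lemma cdist_ge x : `|x| <= 1 / 2 -> 2 * `|x| <= cdist x.
Proof.
wlog x0 : x / 0 <= x => [H|].
  have [/H//|/ltW x0] := leP 0 x.
  by have := H (- x); rewrite cdistN !normrN oppr_ge0; exact.
rewrite ger0_norm // => x2; rewrite cdistE.
have p2 := pi_ge2 R.
have := @sin_ge_half (pi * x); have := ler_norm (sin (pi * x)).
move=> h1 h2; have h3 : pi * x / 2 <= sin (pi * x) by apply: h2; nra.
nra.
Qed.

(** The integer nearest to [x] is at distance at most one half, where
    [cdist_ge] applies. Its upper bound is what later confines the numerators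
    to a bounded range. *)
Lemma cdist_round x : 0 <= x ->
  exists2 m : nat, m%:R <= x + 1 / 2 & 2 * `|x - m%:R| <= cdist x.
Proof.
move=> x0; have x20 : 0 <= x + 1 / 2 by lra.
have := truncn_itv x20; set m := Num.truncn _ => /andP[m1 m2].
rewrite -[m.+1%:R]natr1 in m2; exists m => //.
rewrite -(cdistDint x (- (m : int))) mulrNz -pmulrn; apply: cdist_ge.
by rewrite ler_norml; apply/andP; split; lra.
Qed.

End CircleDistance.

(** * Exponential sums *)

Section Sums.
Variable R : realType.

Lemma normc_sum_le (I : Type) (r : seq I) (P : pred I) (F : I -> R[i]) :
  normc (\sum_(i <- r | P i) F i) <= \sum_(i <- r | P i) normc (F i).
Proof.
elim/big_rec2: _ => [|i y1 y2 _ IH]; first by rewrite normc0.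
by apply: le_trans (le_normcD _ _) _; rewrite lerD2l.
Qed.

(** Summation by parts. The ratio [w k] never comes close to 1, so [c k] is the
    increment of [c k / (w k - 1)], up to an error governed by the variation of
    the ratio. With [eta = 0] this is the bound for a geometric sum; in general
    no monotonicity of the frequencies is needed, and the error term is harmless
    as long as their total variation is below their distance to the integers. *)
Lemma kusmin_landau (c w : nat -> R[i]) (K : nat) (D eta : R) :
  0 < D -> 0 <= eta ->
  (forall k, normc (c k) = 1) ->
  (forall k, (k < K)%N -> c k.+1 = c k * w k) ->
  (forall k, (k <= K)%N -> D <= normc (w k - 1)) ->
  (forall k, (k < K)%N -> normc (w k.+1 - w k) <= eta) ->
  normc (\sum_(0 <= k < K) c k) <= 2 / D + K%:R * (eta / D ^+ 2).
Proof.
move=> D0 eta0 c1 cw wD weta.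
have w1 k : (k <= K)%N -> w k - 1 != 0.
  move=> /wD; apply: contraTneq => ->; rewrite normc0; lra.
pose T k := c k / (w k - 1).
have T_le k : (k <= K)%N -> normc (T k) <= D^-1.
  move=> kK; rewrite normcM normcV c1 mul1r lef_pV2 ?posrE ?wD //.
  by apply: lt_le_trans (wD _ kK).
have step k : (k < K)%N ->
    c k = T k.+1 - T k + c k.+1 * ((w k.+1 - w k) / ((w k - 1) * (w k.+1 - 1))).
  move=> kK; rewrite /T cw //.
  have h1 := w1 _ (ltnW kK); have h2 := w1 _ kK.
  by field; rewrite h1 h2.
have -> : \sum_(0 <= k < K) c k = (T K - T 0%N) + \sum_(0 <= k < K)
   c k.+1 * ((w k.+1 - w k) / ((w k - 1) * (w k.+1 - 1))).
  rewrite -telescope_sumr // -big_split /=.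
  by apply: eq_big_nat => k /andP[_ kK]; exact: step.
apply: le_trans (le_normcD _ _) _; apply: lerD.
  apply: le_trans (le_normcD _ _) _; rewrite normcN.
  by have := T_le _ (leqnn K); have := T_le _ (leq0n K); lra.
apply: le_trans (normc_sum_le _ _ _) _.
rewrite mulr_natl -[K in leRHS]subn0 -sumr_const_nat.
rewrite big_nat [leRHS]big_nat; apply: ler_sum => k /andP[_ kK].
rewrite normcM c1 mul1r normcM normcV normcM.
apply: ler_pM; rewrite ?weta //.
- exact: normc_ge0.
- by rewrite invr_ge0 mulr_ge0 ?normc_ge0.
rewrite lef_pV2 ?posrE ?exprn_gt0 //; last first.
  by rewrite mulr_gt0 // (lt_le_trans D0) ?wD // ltnW.
by rewrite expr2; apply: ler_pM; rewrite ?wD ?ltW // ltnW.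
Qed.

Lemma normc_sqr (z : R[i]) : normc z ^+ 2 = complex.Re (z * z^*%C).
Proof. by case: z => a b; rewrite /normc sqr_sqrtr ?addr_ge0 ?sqr_ge0 //=; ring. Qed.

Lemma Re_le_normc (z : R[i]) : complex.Re z <= normc z.
Proof.
case: z => a b /=; apply: le_trans (ler_norm _) _.
by rewrite -sqrtr_sqr ler_wsqrtr // lerDl sqr_ge0.
Qed.

(** Weyl differencing, kept one-sided: the terms with [m > n] are conjugate to
    those with [m < n], so doubling the real part of the triangle [m <= n]
    recovers the square and counts the diagonal twice. *)
Lemma sqr_sum_le (c : nat -> R[i]) (N : nat) :
  normc (\sum_(0 <= n < N) c n) ^+ 2 <=
  2 * normc (\sum_(0 <= n < N) \sum_(0 <= h < n.+1) c n * (c (n - h)%N)^*%C).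
Proof.
set T := fun N => \sum_(0 <= n < N) \sum_(0 <= h < n.+1) c n * (c (n - h)%N)^*%C.
set S := fun N => \sum_(0 <= n < N) c n.
rewrite -/(S N) -/(T N).
suff H : normc (S N) ^+ 2 <= 2 * complex.Re (T N).
  by apply: le_trans H _; rewrite ler_pM2l ?Re_le_normc.
elim: N => [|N IH]; first by rewrite /S /T !big_geq // normc0 expr0n mulr0.
have -> : T N.+1 = T N + c N * (S N.+1)^*%C.
  rewrite /T big_nat_recr //=; congr (_ + _).
  rewrite -mulr_sumr; congr (_ * _); rewrite /S big_nat_rev /=.
  rewrite rmorph_sum /= big_nat [RHS]big_nat; apply: eq_bigr => h /andP[_ hN].
  by rewrite add0n subSS subKn.
have SE : S N.+1 = S N + c N by rewrite /S big_nat_recr.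
move: IH; rewrite !normc_sqr SE.
case: (S N) => a b; case: (T N) => u v; case: (c N) => p q /=.
have := sqr_ge0 p; have := sqr_ge0 q.
rewrite !expr2; lra.
Qed.

End Sums.

(** * Rational approximation and sums over residues *)

Section Arith.
Variable R : realType.

(** Two of the [M + 1] fractional parts of [k * th] fall in the same of [M]
    boxes; the difference of their indices is the denominator. *)
Lemma dirichlet_pigeonhole (th : R) (M : nat) : 0 <= th -> (0 < M)%N ->
  exists q a : nat, [/\ (0 < q <= M)%N & `|q%:R * th - a%:R| <= M%:R^-1].
Proof.
move=> th0 M0; have MR : 0 < M%:R :> R by rewrite ltr0n.
pose fl k := Num.truncn (k%:R * th).
have kth k : 0 <= k%:R * th by rewrite mulr_ge0.
have flP k : (fl k)%:R <= k%:R * th < (fl k)%:R + 1.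
  by rewrite natr1; exact: truncn_itv.
pose fr k := M%:R * (k%:R * th - (fl k)%:R).
have fr0 k : 0 <= fr k by rewrite mulr_ge0 ?(ltW MR) //; have /andP[] := flP k; lra.
have frM k : fr k < M%:R by rewrite gtr_pMr //; have /andP[] := flP k; lra.
have trM k : (Num.truncn (fr k) < M)%N by rewrite truncn_lt_nat.
pose f (k : 'I_M.+1) : 'I_M := Ordinal (trM k).
have [i [j [ij fij]]] : exists i j : 'I_M.+1, (i < j)%N /\ f i = f j.
  have /injectivePn : ~~ injectiveb f.
    by apply/negP => /injectiveP /leq_card; rewrite !card_ord ltnn.
  move=> [i [j ij fij]].
  have [lt|gt|/val_inj e] := ltngtP i j; first by exists i, j.
    by exists j, i.
  by rewrite e eqxx in ij.
exists (j - i)%N, (fl j - fl i)%N.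
have fle : (fl i <= fl j)%N by apply: le_truncn; rewrite ler_wpM2r // ler_nat ltnW.
split.
  by rewrite subn_gt0 ij /=; have := ltn_ord j; lia.
rewrite !natrB ?(ltnW ij) //.
have e : Num.truncn (fr i) = Num.truncn (fr j) by case: fij.
have /andP[i1 i2] := truncn_itv (fr0 i).
have /andP[j1 j2] := truncn_itv (fr0 j).
rewrite e in i1 i2; rewrite -[_.+1%:R]natr1 in i2; rewrite -[_.+1%:R]natr1 in j2.
rewrite -(ler_pM2l MR) mulfV ?gt_eqF //.
have -> : M%:R * `|(j%:R - i%:R) * th - ((fl j)%:R - (fl i)%:R)| = `|fr j - fr i|.
  rewrite -[X in X * _](ger0_norm (ltW MR)) -normrM; congr `|_|.
  by rewrite /fr; ring.
by rewrite ler_norml; apply/andP; split; lra.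
Qed.

Lemma dirichlet_coprime (th : R) (M : nat) : 0 <= th -> (0 < M)%N ->
  exists q a : nat, [/\ (0 < q <= M)%N, coprime q a & `|q%:R * th - a%:R| <= M%:R^-1].
Proof.
move=> th0 M0; have [q [a [/andP[q0 qM] qa]]] := dirichlet_pigeonhole th0 M0.
pose g := gcdn q a; have g0 : (0 < g)%N by rewrite gcdn_gt0 q0.
have qE : q = (q %/ g * g)%N by rewrite divnK // dvdn_gcdl.
have aE : a = (a %/ g * g)%N by rewrite divnK // dvdn_gcdr.
exists (q %/ g)%N, (a %/ g)%N; split.
- by rewrite divn_gt0 // dvdn_leq ?dvdn_gcdl //= (leq_trans (leq_div _ _)).
- rewrite /coprime -(eqn_pmul2r g0) mul1n muln_gcdl -qE -aE eqxx //.
apply: le_trans qa; rewrite [in leRHS]qE [in leRHS]aE !natrM.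
have -> : (q %/ g)%:R * g%:R * th - (a %/ g)%:R * g%:R =
  ((q %/ g)%:R * th - (a %/ g)%:R) * g%:R by ring.
by rewrite normrM ler_peMr // normr_nat ler1n.
Qed.

Lemma sum_periodic (F : nat -> R) (q K : nat) : (forall h, F (h + q)%N = F h) ->
  \sum_(0 <= h < K * q) F h = (\sum_(0 <= i < q) F i) *+ K.
Proof.
move=> Fq; have FK K' h : F (K' * q + h)%N = F h.
  elim: K' => [|K' IH]; first by rewrite mul0n.
  by rewrite mulSn -addnA addnC Fq.
elim: K => [|K IH]; first by rewrite mul0n big_geq // mulr0n.
rewrite (big_cat_nat (n := (K * q)%N)) //=; last by rewrite leq_mul.
rewrite IH mulrSr; congr (_ + _).
rewrite -{1}[(K * q)%N]add0n big_addn mulSn addnK.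
by apply: eq_bigr => i _; rewrite addnC FK.
Qed.

(** Multiplication by a unit permutes the residues. *)
Lemma sum_mul_coprime (G : nat -> R) (q a : nat) : (0 < q)%N -> coprime q a ->
  \sum_(0 <= i < q) G ((i * a) %% q)%N = \sum_(0 <= i < q) G i.
Proof.
move=> q0 cop; rewrite !big_mkord.
pose f (i : 'I_q) : 'I_q := Ordinal (ltn_pmod (i * a) q0).
rewrite [RHS](reindex_inj (h := f)) //.
move=> i j [] /eqP.
wlog ij : i j / (i <= j)%N => [H|].
  by have /orP[|] := leq_total i j => ?; [|rewrite eq_sym => e; apply/esym]; exact: H.
rewrite eq_sym eqn_mod_dvd ?leq_mul2r ?ij ?orbT // -mulnBl Gauss_dvdl // => d.
apply/val_inj/eqP => /=; rewrite eqn_leq ij /= -subn_eq0.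
apply/negPn/negP; rewrite -lt0n => p; have := dvdn_leq p d.
by have := ltn_ord j; lia.
Qed.

(** Each new term is paid for by [- ln (1 - 1 / (q + 1)) >= 1 / (q + 1)]. *)
Lemma harmonic_le (q : nat) : (0 < q)%N ->
  \sum_(1 <= r < q.+1) (r%:R)^-1 <= 1 + ln q%:R :> R.
Proof.
elim: q => // -[_ _|q IH _]; first by rewrite big_nat1 invr1 ln1 addr0.
rewrite big_nat_recr //=; have := IH isT.
set n := q.+1%:R : R; have n0 : 0 < n by rewrite ltr0n.
have -> : q.+2%:R = n + 1 :> R by rewrite natr1.
have n1 : 0 < n + 1 by lra.
have h : ln n - ln (n + 1) <= - (n + 1)^-1.
  rewrite -ln_div ?posrE //.
  have -> : n / (n + 1) = 1 + - (n + 1)^-1 by field; lra.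
  apply: le_ln1Dx; rewrite ltrN2 invf_lt1 //; lra.
lra.
Qed.

Lemma cdist_natdiv (n q : nat) : (0 < q)%N ->
  cdist (n%:R / q%:R : R) = cdist ((n %% q)%:R / q%:R).
Proof.
move=> q0; rewrite {1}(divn_eq n q) natrD natrM mulrDl mulfK ?pnatr_eq0 -?lt0n //.
by rewrite addrC; exact: (cdistDint _ (n %/ q)%N).
Qed.

Lemma cdist_ratio_ge (q r : nat) : (0 < r < q)%N ->
  2 / q%:R <= cdist (r%:R / q%:R : R) /\
  (cdist (r%:R / q%:R : R))^-1 <= q%:R / 2 * (r%:R^-1 + (q - r)%:R^-1).
Proof.
move=> /andP[r0 rq]; have q0 : 0 < q%:R :> R by rewrite ltr0n (leq_trans r0 (ltnW rq)).
have key (s : nat) : (0 < s)%N -> s%:R / q%:R <= 1 / 2 :> R ->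
  cdist (s%:R / q%:R : R) = cdist (r%:R / q%:R : R) ->
  2 / q%:R <= cdist (r%:R / q%:R : R) /\
  (cdist (r%:R / q%:R : R))^-1 <= q%:R / 2 * s%:R^-1.
  move=> s0 sq <-; have sR : 1 <= s%:R :> R by rewrite ler1n.
  have sq0 : 0 < s%:R / q%:R :> R by rewrite divr_gt0 // ltr0n.
  have := @cdist_ge R (s%:R / q%:R); rewrite ger0_norm ?(ltW sq0) // => /(_ sq) h.
  split; first by apply: le_trans h; rewrite ler_pM2l // ler_peMl ?invr_ge0 // ltW.
  have -> : q%:R / 2 * s%:R^-1 = (2 * (s%:R / q%:R))^-1 :> R.
    by rewrite !invfM invrK; ring.
  have h0 : 0 < 2 * (s%:R / q%:R) :> R by rewrite mulr_gt0.
  by rewrite lef_pV2 ?posrE //; apply: lt_le_trans h.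
have iv (s : nat) : 0 <= (s%:R)^-1 :> R by rewrite invr_ge0.
have hq : 0 <= q%:R / 2 :> R by lra.
have [h|h] := leP (r%:R / q%:R : R) (1 / 2).
  have [|||h1 h2] := key r => //; split=> //; apply: le_trans h2 _.
  by rewrite ler_wpM2l // lerDl.
have qrE : (q - r)%:R / q%:R = - (r%:R / q%:R) + 1 :> R.
  by rewrite natrB ?(ltnW rq) // mulrBl divff ?gt_eqF // addrC.
have [|||h1 h2] := key (q - r)%N; first by rewrite subn_gt0.
- by rewrite qrE; lra.
- by rewrite qrE (_ : 1 = 1%:~R) // cdistDint cdistN.
split=> //; apply: le_trans h2 _.
by rewrite ler_wpM2l // lerDr.
Qed.

(** The summand depends only on [h * a] modulo [q], and over a full period
    [h * a] runs through the nonzero residues; there the chord lengths are those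
    of [r / q], whose inverses add up to a harmonic sum. At most [N / q + 1]
    periods are needed. *)
Lemma sum_nonmultiple_le (q a N : nat) : (0 < q)%N -> coprime q a ->
  \sum_(0 <= h < N | ~~ (q %| h)%N)
     (cdist ((h * a)%:R / q%:R : R))^-1 <= (N + q)%:R * (1 + ln q%:R).
Proof.
move=> q0 cop; have qR : 0 < q%:R :> R by rewrite ltr0n.
pose G (r : nat) : R := if r == 0%N then 0 else (cdist (r%:R / q%:R : R))^-1.
have G0 r : 0 <= G r by rewrite /G; case: eqP => // _; rewrite invr_ge0 cdist_ge0.
have -> : \sum_(0 <= h < N | ~~ (q %| h)%N) (cdist ((h * a)%:R / q%:R : R))^-1
   = \sum_(0 <= h < N) G ((h * a) %% q)%N.
  rewrite big_mkcond; apply: eq_bigr => h _; rewrite /G.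
  by rewrite cdist_natdiv // -[_ == 0%N]/(q %| _)%N Gauss_dvdl //; case: (q %| h)%N.
have GH : \sum_(0 <= i < q) G i <= q%:R * (1 + ln q%:R).
  pose H := \sum_(1 <= r < q) (r%:R)^-1 : R.
  have HE : \sum_(1 <= r < q) ((q - r)%:R)^-1 = H.
    by rewrite /H [RHS]big_nat_rev; apply: eq_big_nat => r _; rewrite add1n subSS.
  have Hle : H <= 1 + ln q%:R.
    apply: le_trans (harmonic_le q0).
    by rewrite big_nat_recr //= lerDl invr_ge0.
  rewrite big_ltn // {1}/G eqxx add0r.
  apply: (@le_trans _ _ (\sum_(1 <= r < q) q%:R / 2 * (r%:R^-1 + (q - r)%:R^-1))).
    rewrite big_nat [leRHS]big_nat; apply: ler_sum => r /andP[r0 rq].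
    by rewrite /G gtn_eqF //; apply: (cdist_ratio_ge _).2; rewrite r0.
  by rewrite -mulr_sumr big_split /= HE -/H; nra.
have K0 : 0 <= \sum_(0 <= i < q) G i by apply: sumr_ge0.
apply: (@le_trans _ _ (\sum_(0 <= h < (N %/ q).+1 * q) G ((h * a) %% q)%N)).
  rewrite [leRHS](big_cat_nat (n := N)) //=; last exact/ltnW/ltn_ceil.
  by rewrite lerDl; apply: sumr_ge0.
rewrite (@sum_periodic (fun h => G ((h * a) %% q)%N)); last first.
  by move=> h; rewrite mulnDl -modnDmr modnMr addn0.
rewrite sum_mul_coprime // -[leLHS]mulr_natl.
apply: (@le_trans _ _ ((N %/ q).+1%:R * (q%:R * (1 + ln q%:R)))).
  by rewrite ler_wpM2l.
rewrite mulrA -natrM ler_wpM2r //; last first.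
  by rewrite ler_nat mulSn addnC leq_add2r leq_trunc_div.
by have := harmonic_le q0; apply: le_trans; apply: sumr_ge0.
Qed.

End Arith.

(** * The two kinds of shifts in the squared Weyl sum *)

Section LargeValues.
Variable R : realType.

(** The phase of [c n * conj (c (n - h))] when [c n] is the term of index [n + 1]
    of the Weyl sum: linear in [n] for a fixed shift [h], quadratic in [h] for a
    fixed [n]. *)
Definition phase (x t : R) (n h : nat) : R :=
  h%:R * x + 2 * n.+1%:R * h%:R * t - h%:R ^+ 2 * t.

Lemma weyl_sum_sqr_le (N : nat) (x t : R) :
  normc (weyl_sum N x t) ^+ 2 <=
  2 * normc (\sum_(0 <= n < N) \sum_(0 <= h < n.+1) ee (phase x t n h)).
Proof.
pose c n := ee (n.+1%:R * x + n.+1%:R ^+ 2 * t).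
have -> : weyl_sum N x t = \sum_(0 <= n < N) c n by rewrite /weyl_sum big_add1.
have <- : \sum_(0 <= n < N) \sum_(0 <= h < n.+1) c n * (c (n - h)%N)^*%C =
    \sum_(0 <= n < N) \sum_(0 <= h < n.+1) ee (phase x t n h); last exact: sqr_sum_le.
apply: eq_bigr => n _; apply: eq_big_nat => h /andP[_ hn].
rewrite /c conjc_ee -eeD; congr ee.
by rewrite /phase -subSn // natrB 1?ltnW //; ring.
Qed.

Lemma sum_multiples (f : nat -> R[i]) (q n : nat) : (0 < q)%N ->
  \sum_(0 <= h < n.+1 | (q %| h)%N) f h = \sum_(0 <= k < (n %/ q).+1) f (k * q)%N.
Proof.
move=> q0; elim: n => [|n IH].
  by rewrite div0n big_mkcond !big_nat1 dvdn0.
rewrite big_mkcond big_nat_recr //= -big_mkcond IH divnS //.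
case: ifP => [d|_]; last by rewrite addr0.
rewrite add1n [RHS]big_nat_recr //=; congr (_ + f _).
by rewrite -{1}(divnK d) divnS // d.
Qed.

(** For a fixed shift [h] the sum over [n] is geometric with ratio [ee (2 h t)].
    As [2 t] is very close to [a / q], and [q] does not divide [h], this ratio is
    as far from 1 as [ee (h a / q)] up to a factor 2. *)
Lemma nonmultiple_le (N q a M : nat) (x t : R) :
  (0 < q)%N -> coprime q a -> (0 < M)%N -> (8 * N <= M)%N ->
  `|q%:R * (2 * t) - a%:R| <= M%:R^-1 ->
  normc (\sum_(0 <= n < N) \sum_(0 <= h < n.+1 | ~~ (q %| h)%N) ee (phase x t n h))
  <= 4 * ((N + q)%:R * (1 + ln q%:R)).
Proof.
move=> q0 cop M0 NM qta.
have qR : 0 < q%:R :> R by rewrite ltr0n.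
have MR : 0 < M%:R :> R by rewrite ltr0n.
have -> : \sum_(0 <= n < N) \sum_(0 <= h < n.+1 | ~~ (q %| h)%N) ee (phase x t n h)
  = \sum_(0 <= h < N | ~~ (q %| h)%N) \sum_(h <= n < N) ee (phase x t n h).
  transitivity (\sum_(0 <= n < N)
     \sum_(0 <= h < N | ~~ (q %| h)%N && (h < n.+1)%N) ee (phase x t n h)).
    by apply: eq_big_nat => n /andP[_ nN]; rewrite (big_nat_widen 0 n.+1 N).
  rewrite (exchange_big_dep (fun h => ~~ (q %| h)%N)) /=; last by move=> ? ? _ /andP[].
  apply: eq_bigr => h qh; rewrite (big_nat_widenl h 0) //.
  by apply: eq_bigl => n; rewrite qh.
apply: le_trans (normc_sum_le _ _ _) _.
apply: le_trans (ler_wpM2l _ (@sum_nonmultiple_le R q a N q0 cop)); last by [].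
rewrite mulr_sumr big_nat_cond [leRHS]big_nat_cond.
apply: ler_sum => h /andP[/andP[_ hN] qh].
have r0 : (0 < (h * a) %% q < q)%N.
  by rewrite ltn_mod q0 andbT lt0n -[_ == 0%N]/(q %| _)%N Gauss_dvdl.
have [E1 _] := @cdist_ratio_ge R _ _ r0; rewrite -cdist_natdiv // in E1.
set E := cdist _ in E1 *.
have E0 : 0 < E by apply: lt_le_trans E1; rewrite divr_gt0.
(* 8 N <= M makes the error at most 1 / q, half of the smallest chord 2 / q. *)
have DE : E / 2 <= cdist (2 * h%:R * t).
  have := @cdistB_ge R ((h * a)%:R / q%:R) ((h * a)%:R / q%:R - 2 * h%:R * t).
  rewrite subKr -/E.
  have := @cdist_le R ((h * a)%:R / q%:R - 2 * h%:R * t).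
  have -> : (h * a)%:R / q%:R - 2 * h%:R * t
    = - (q%:R * (2 * t) - a%:R) * (h%:R / q%:R).
    by rewrite natrM; field; rewrite gt_eqF.
  rewrite normrM normrN ger0_norm; last by rewrite divr_ge0.
  have : `|q%:R * (2 * t) - a%:R| * (h%:R / q%:R) <= M%:R^-1 * (M%:R / 8 / q%:R).
    apply: ler_pM => //.
    rewrite ler_wpM2r ?invr_ge0 ?(ltW qR) // ler_pdivlMr // mulrC -natrM ler_nat.
    by apply: leq_trans NM; rewrite leq_mul2l ltnW.
  have -> : M%:R^-1 * (M%:R / 8 / q%:R) = (8 * q%:R)^-1 :> R.
    by field; rewrite !gt_eqF.
  move: E1; rewrite invfM; lra.
have D0 : 0 < cdist (2 * h%:R * t) by apply: lt_le_trans DE; lra.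
rewrite -{1}[h]add0n big_addn.
apply: (@le_trans _ _ (2 / cdist (2 * h%:R * t))); last first.
  rewrite -lef_pV2 ?posrE in DE; [|lra|lra].
  by rewrite invfM invrK in DE; lra.
have -> : 2 / cdist (2 * h%:R * t) = 2 / cdist (2 * h%:R * t) +
  (N - h)%:R * (0 / cdist (2 * h%:R * t) ^+ 2) by rewrite mul0r mulr0 addr0.
apply: (@kusmin_landau R _ (fun=> ee (2 * h%:R * t))) => //.
- by move=> k; rewrite normc_ee.
- move=> k _; rewrite -eeD; congr ee; rewrite /phase addSn.
  by rewrite -[(k + h).+2%:R]natr1; ring.
- by move=> k _; rewrite subrr normc0.
Qed.

Lemma multiple_trivial_le (N q : nat) (x t : R) : (0 < q)%N ->
  normc (\sum_(0 <= n < N) \sum_(0 <= h < n.+1 | (q %| h)%N) ee (phase x t n h))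
  <= N%:R * (N%:R / q%:R + 1).
Proof.
move=> q0; have qR : 0 < q%:R :> R by rewrite ltr0n.
apply: le_trans (normc_sum_le _ _ _) _.
rewrite mulr_natl -[N in leRHS]subn0 -sumr_const_nat.
rewrite big_nat [leRHS]big_nat; apply: ler_sum => n /andP[_ nN].
rewrite sum_multiples //; apply: le_trans (normc_sum_le _ _ _) _.
under eq_bigr do rewrite normc_ee.
rewrite sumr_const_nat subn0 -natr1 lerD2r ler_pdivlMr // -natrM ler_nat subn0.
by apply: leq_trans (leq_trunc_div _ _) (ltnW nN).
Qed.

(** For a fixed [n], the shifts [h = k q] have successive phase differences equal,
    modulo 1, to [q x - q a / 2] up to [O(N / M)]: the factor one half comes from
    [h ^ 2 t = k ^ 2 q (a + b) / 2] with [b = q (2 t) - a], and [k ^ 2] has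
    the parity of [k]. So [kusmin_landau] bounds each inner sum by the inverse chord of
    that single frequency, which does not depend on [n]. *)
Lemma multiple_le (N q a M : nat) (x t : R) :
  (0 < q <= N)%N -> (0 < M)%N ->
  `|q%:R * (2 * t) - a%:R| <= M%:R^-1 ->
  0 < cdist (q%:R * x - q%:R * a%:R / 2) ->
  48 * N%:R / M%:R <= cdist (q%:R * x - q%:R * a%:R / 2) ->
  normc (\sum_(0 <= n < N) \sum_(0 <= h < n.+1 | (q %| h)%N) ee (phase x t n h))
  <= N%:R * (6 / cdist (q%:R * x - q%:R * a%:R / 2)).
Proof.
move=> /andP[q0 qN] M0 qta; set y := q%:R * x - _; set D := cdist y => D0 MD.
have MR : 0 < M%:R :> R by rewrite ltr0n.
have MV : 0 < M%:R^-1 :> R by rewrite invr_gt0.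
apply: le_trans (normc_sum_le _ _ _) _.
rewrite mulr_natl -[N in leRHS]subn0 -sumr_const_nat.
rewrite big_nat [leRHS]big_nat; apply: ler_sum => n /andP[_ nN].
rewrite sum_multiples //.
set b := q%:R * (2 * t) - a%:R in qta.
have tE : q%:R * t = (a%:R + b) / 2 by rewrite /b; field.
pose th (k : nat) : R := q%:R * x + 2 * n.+1%:R * (q%:R * t) - (2 * k%:R + 1) * q%:R * (q%:R * t).
pose K := (n %/ q).+1.
have nN' : n.+1%:R <= N%:R :> R by rewrite ler_nat.
have qN' : q%:R <= N%:R :> R by rewrite ler_nat.
have KqN k : (k <= K)%N -> k%:R * q%:R <= 2 * N%:R :> R.
  move=> kK; apply: (@le_trans _ _ (n%:R + q%:R)); last first.
    by move: nN'; rewrite -natr1; lra.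
  rewrite -natrM -natrD ler_nat; apply: (@leq_trans (K * q)); first by rewrite leq_mul2r kK orbT.
  by rewrite mulSn addnC leq_add2r leq_trunc_div.
have q0R : 0 < q%:R :> R by rewrite ltr0n.
(* Every frequency used keeps half the chord of y; successive ones differ by
   q b modulo 1, that is by a chord of at most 8 q / M. *)
apply: (@le_trans _ _ (2 / (D / 2) + K%:R * ((8 * q%:R / M%:R) / (D / 2) ^+ 2))).
  apply: (@kusmin_landau R _ (fun k => ee (th k))).
  - by rewrite divr_gt0.
  - by rewrite divr_ge0 ?mulr_ge0.
  - by move=> k; rewrite normc_ee.
  - move=> k _; rewrite -eeD; congr ee; rewrite /phase /th !natrM -[k.+1%:R]natr1; ring.
  - move=> k kK; change (D / 2 <= cdist (th k)).
    have -> : th k = y + b * (n.+1%:R - q%:R * (2 * k%:R + 1) / 2)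
        + ((n.+1 * a)%:Z - (q * k * a)%:Z)%:~R.
      by rewrite /th tE /y mulrzBr -!pmulrn !natrM; field.
    rewrite cdistDint.
    have := @cdistB_ge R y (- (b * (n.+1%:R - q%:R * (2 * k%:R + 1) / 2))).
    rewrite opprK cdistN.
    have := @cdist_le R (b * (n.+1%:R - q%:R * (2 * k%:R + 1) / 2)).
    rewrite normrM.
    have : `|b| * `|n.+1%:R - q%:R * (2 * k%:R + 1) / 2| <= M%:R^-1 * (3 * N%:R).
      apply: ler_pM => //; rewrite ler_norml.
      have := KqN _ kK; have : 0 <= k%:R * q%:R :> R by rewrite mulr_ge0.
      have : 0 <= n.+1%:R :> R by [].
      move=> h1 h2 h3; apply/andP; split; lra.
    move: MD; rewrite -/D; lra.
  - move=> k _.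
    have -> : th k.+1 = th k + - (q%:R * b) + - (q * a)%:Z%:~R.
      by rewrite /th tE -pmulrn natrM -[k.+1%:R]natr1; field.
    rewrite -mulrNz eeD ee_int mulr1 eeD -[X in _ - X]mulr1 -mulrBr normcM normc_ee mul1r.
    change (cdist (- (q%:R * b)) <= 8 * q%:R / M%:R).
    rewrite cdistN; apply: le_trans (cdist_le _) _.
    rewrite normrM (ger0_norm (ltW q0R)) -!mulrA ler_pM2l // ler_pM2l //.
have -> : 2 / (D / 2) + K%:R * (8 * q%:R / M%:R / (D / 2) ^+ 2)
   = 4 / D + 32 * (K%:R * q%:R) / M%:R / D / D.
  by field; rewrite !gt_eqF.
have : 32 * (K%:R * q%:R) / M%:R / D / D <= 2 / D.
  rewrite ler_pM2r ?invr_gt0 // ler_pdivrMr //.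
  have := KqN _ (leqnn K) => h; apply: (@le_trans _ _ (64 * N%:R / M%:R)).
    by rewrite ler_pM2r //; lra.
  by lra.
lra.
Qed.

End LargeValues.

(** * Large values of the Weyl sum *)

Section Main.
Variable R : realType.

Lemma weyl_sum_le (N : nat) (x t : R) : normc (weyl_sum N x t) <= N%:R.
Proof.
apply: le_trans (normc_sum_le _ _ _) _.
under eq_bigr => n _ do rewrite (normc_ee (n%:R * x + n%:R ^+ 2 * t)).
by rewrite sumr_const_nat subn1.
Qed.

(** The heart of the argument. Take [q <= M] with [M] about [V ^ 2 / (64 L)]: then
    the shifts not divisible by [q] account for at most half of [V ^ 2], so the
    multiples of [q] must account for the rest. The trivial bound for these
    limits [q], and the bound in terms of the chord of [q x - q a / 2] limits
    this chord. Doubling removes [a / 2], hence the conclusion mentions [x] only,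
    which is what makes it uniform in [t]. *)
Lemma large_value (N : nat) (x t V : R) :
  (0 < N)%N -> 0 <= x <= 1 -> 0 <= t -> 0 < V ->
  2 ^+ 10 * (1 + ln N%:R) * N%:R <= V ^+ 2 ->
  V <= normc (weyl_sum N x t) ->
  exists q m : nat, [/\ (0 < q)%N, (m <= 2 * q)%N, q%:R * V ^+ 2 <= 8 * N%:R ^+ 2 &
    `|2 * q%:R * x - m%:R| * V ^+ 2 <= 2 ^+ 13 * (1 + ln N%:R) * N%:R].
Proof.
move=> N0 /andP[x0 x1] t0 V0; set L := 1 + ln _ => VL VS.
have NR : 1 <= N%:R :> R by rewrite ler1n.
have L1 : 1 <= L by rewrite /L lerDl ln_ge0.
have VN : V ^+ 2 <= N%:R ^+ 2.
  by rewrite ler_sqr ?nnegrE ?(ltW V0) // (le_trans VS) // weyl_sum_le.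
pose W := V ^+ 2 / (64 * L).
have WE : W * (64 * L) = V ^+ 2 by rewrite /W divfK // gt_eqF //; lra.
have W16 : 16 * N%:R <= W.
  by rewrite /W ler_pdivlMr; lra.
have W0 : 0 <= W by lra.
pose M := Num.truncn W; have /andP[MW WM] := truncn_itv W0.
rewrite -/M in MW WM; rewrite -[M.+1%:R]natr1 in WM.
have M1 : 15 <= M%:R :> R by lra.
have MN : 8 * N%:R <= M%:R :> R by lra.
have M0 : (0 < M)%N by rewrite -(ltr0n R); lra.
have MN' : (8 * N <= M)%N by rewrite -(ler_nat R) natrM.
have t20 : 0 <= 2 * t by lra.
have [q [a [/andP[q0 qM] cop qta]]] := dirichlet_coprime t20 M0.
have qR : 1 <= q%:R :> R by rewrite ler1n.
have qMR : q%:R <= M%:R :> R by rewrite ler_nat.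
(* M <= V^2 <= N^2, as no Weyl sum exceeds N. *)
have lnq : 1 + ln q%:R <= 2 * L.
  have : ln q%:R <= ln (N%:R ^+ 2) :> R.
    rewrite ler_ln ?posrE ?exprn_gt0 //; [|lra|lra]. 
    by apply: le_trans VN; nra.
  by rewrite lnXn /L; [rewrite mulr2n|]; lra.
have S2 := weyl_sum_sqr_le N x t.
pose A := \sum_(0 <= n < N) \sum_(0 <= h < n.+1 | ~~ (q %| h)%N) ee (phase x t n h).
pose B := \sum_(0 <= n < N) \sum_(0 <= h < n.+1 | (q %| h)%N) ee (phase x t n h).
have SAB : \sum_(0 <= n < N) \sum_(0 <= h < n.+1) ee (phase x t n h) = B + A.
  rewrite /A /B -big_split /=; apply: eq_bigr => n _.
  by rewrite (bigID (fun h => q %| h)%N).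
have A_le : normc A <= 4 * ((N + q)%:R * (1 + ln q%:R)) by exact: nonmultiple_le cop M0 MN' qta.
have V2 : V ^+ 2 <= 2 * (normc B + normc A).
  apply: le_trans (le_trans S2 _); last first.
    by rewrite SAB ler_pM2l // le_normcD.
  by rewrite ler_sqr ?nnegrE ?normc_ge0 // ltW.
have A_le2 : 2 * normc A <= V ^+ 2 / 2.
  have : (N + q)%:R * (1 + ln q%:R) <= (9 / 8 * W) * (2 * L).
    apply: ler_pM => //; last by rewrite natrD; lra.
    by have := ln_ge0 qR; lra.
  by rewrite -WE; nra.
have B_ge : V ^+ 2 <= 4 * normc B by lra.
have N4 : 2 ^+ 10 * N%:R <= V ^+ 2 by apply: le_trans VL; nra.
have V20 : 0 < V ^+ 2 by rewrite exprn_gt0.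
have qV : q%:R * V ^+ 2 <= 8 * N%:R ^+ 2.
  have h : V ^+ 2 <= 4 * (N%:R * (N%:R / q%:R + 1)).
    by apply: le_trans B_ge _; rewrite ler_pM2l // multiple_trivial_le.
  have h2 : V ^+ 2 <= 8 * N%:R ^+ 2 / q%:R.
    have -> : 8 * N%:R ^+ 2 / q%:R = 8 * (N%:R * (N%:R / q%:R)) :> R.
      by rewrite expr2; field; rewrite gt_eqF //; lra.
    lra.
  by rewrite ler_pdivlMr in h2; lra.
(* The range of k is then at most 2 N / q, as the error terms above require. *)
have qN : (q <= N)%N.
  rewrite -(ler_nat R); have : q%:R * (2 ^+ 10 * N%:R) <= 8 * N%:R ^+ 2 :> R.
    by apply: le_trans qV; rewrite ler_pM2l //; lra.
  rewrite expr2; nra.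
pose y := q%:R * x - q%:R * a%:R / 2.
have yV : cdist y * V ^+ 2 <= 2 ^+ 13 * L * N%:R.
  have [h|h] := leP (48 * N%:R / M%:R) (cdist y); last first.
    have hM : cdist y * M%:R <= 48 * N%:R by rewrite -ler_pdivlMr ?ltW //; lra.
    have W2 : W <= 2 * M%:R by lra.
    have : cdist y * W <= 96 * N%:R by have := cdist_ge0 y; nra.
    by rewrite -WE; nra.
  have D0 : 0 < cdist y by apply: lt_le_trans h; rewrite divr_gt0 //; lra.
  have hB : normc B <= N%:R * (6 / cdist y).
    by apply: (@multiple_le R N q a M); rewrite ?q0.
  have : V ^+ 2 <= 24 * N%:R / cdist y.
    have -> : 24 * N%:R / cdist y = 4 * (N%:R * (6 / cdist y)).
      by field; rewrite gt_eqF.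
    lra.
  by rewrite ler_pdivlMr // mulrC; nra.
have [|m m1 m2] := @cdist_round R (2 * q%:R * x); first by rewrite !mulr_ge0.
exists q, m; split => //.
  rewrite -ltnS -(ltr_nat R) -natr1 natrM.
  have : q%:R * x <= q%:R by rewrite ler_piMr.
  by lra.
have yE : cdist (2 * q%:R * x) = cdist (y + y).
  rewrite -(cdistDint (y + y) (q * a)%N) -pmulrn natrM; congr cdist.
  by rewrite /y; field.
have := cdistD y y; rewrite -yE => yy.
have : `|2 * q%:R * x - m%:R| <= cdist y by lra.
by move=> h; apply: le_trans yV; rewrite ler_pM2r.
Qed.

End Main.

(** * Integrals of step majorants *)

Section Integral.
Variable R : realType.
Local Open Scope classical_set_scope.
Local Notation mu := (@lebesgue_measure R).
Local Notation I01 := (`[0%R, 1%R]%classic : set R).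

(** A bound on the integral bundled with the measurability and the sign that are
    needed to add up such bounds. *)
Definition integral_bound (g : R -> R) (v : R) :=
  [/\ forall x, 0 <= g x, measurable_fun setT g &
   (\int[mu]_(x in I01) (g x)%:E <= v%:E)%E].

Lemma integral_bound_cst (c : R) : 0 <= c -> integral_bound (fun=> c) c.
Proof.
move=> c0; split => //.
rewrite integral_cst //= lebesgue_measure_itv /= lte_fin ltr01.
by rewrite -EFinD subr0 mule1.
Qed.

Lemma integral_bound_indic (c a b : R) : 0 <= c -> a <= b ->
  integral_bound (fun x => c * \1_(`[a, b]) x) (c * (b - a)).
Proof.
move=> c0 ab; split.
- by move=> x; rewrite mulr_ge0.
- by apply: measurable_funM => //; exact: measurable_indic.
under eq_integral do rewrite EFinM.
rewrite ge0_integralZl_EFin //; last first.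
  by apply/measurable_EFinP; exact: measurable_indic.
rewrite integral_indic // EFinM lee_wpmul2l ?lee_fin //.
apply: (@le_trans _ _ (mu `[a, b]%classic)).
  by apply: le_measure; rewrite ?inE //; exact: measurableI.
rewrite lebesgue_measure_itv /= lte_fin; case: ifP => [_|_].
  by rewrite -EFinD.
by rewrite lee_fin subr_ge0.
Qed.

Lemma integral_boundD (g1 g2 : R -> R) (v1 v2 : R) :
  integral_bound g1 v1 -> integral_bound g2 v2 ->
  integral_bound (fun x => g1 x + g2 x) (v1 + v2).
Proof.
move=> [g10 mg1 h1] [g20 mg2 h2]; split.
- by move=> x; rewrite addr_ge0.
- exact: measurable_funD.
under eq_integral do rewrite EFinD.
rewrite ge0_integralD //; last 4 first.
- by move=> x _; rewrite lee_fin.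
- by apply/measurable_EFinP; exact: measurable_funTS.
- by move=> x _; rewrite lee_fin.
- by apply/measurable_EFinP; exact: measurable_funTS.
by rewrite EFinD leeD.
Qed.

Lemma integral_bound_sum (I : Type) (s : seq I) (g : I -> R -> R) (v : I -> R) :
  (forall i, integral_bound (g i) (v i)) ->
  integral_bound (fun x => \sum_(i <- s) g i x) (\sum_(i <- s) v i).
Proof.
move=> H; elim: s => [|i s IH].
  by under eq_fun do rewrite big_nil; rewrite big_nil; exact: integral_bound_cst.
by under eq_fun do rewrite big_cons; rewrite big_cons; exact: integral_boundD.
Qed.

(** The integral of a nonnegative function is a supremum over the simple functions
    below it, so only the majorant has to be measurable. *)
Lemma integral_le_of_majorant (f : R -> \bar R) (g : R -> R) (v : R) :
  (forall x, (0 <= f x)%E) -> integral_bound g v ->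
  (forall x, 0 <= x <= 1 -> (f x <= (g x)%:E)%E) ->
  (\int[mu]_(x in I01) f x <= v%:E)%E.
Proof.
move=> f0 [g0 mg gv] fg; apply: le_trans gv.
rewrite !ge0_integralE //; last by move=> x _; rewrite lee_fin.
apply: le_ereal_sup => _ [h hf <-]; exists h => // x.
apply: le_trans (hf x) _; rewrite /patch; case: ifPn => // /set_mem /=.
by rewrite in_itv /=; exact: fg.
Qed.

Lemma weyl_maximal_ge0 (N : nat) (x : R) : (0 <= weyl_maximal N x)%E.
Proof.
apply: (@le_trans _ _ (normc (weyl_sum N x (1 / 2)))%:E).
  by rewrite lee_fin normc_ge0.
apply: ereal_sup_ubound; exists (1 / 2) => //=; rewrite in_itv /=.
by apply/andP; split; lra.
Qed.

Lemma weyl_maximal_pow4_le (N : nat) (x g : R) : 0 <= g ->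
  (forall t, 0 < t < 1 -> normc (weyl_sum N x t) ^+ 4 <= g) ->
  (weyl_maximal N x ^+ 4 <= g%:E)%E.
Proof.
move=> g0 H; pose r := g `^ 4^-1.
have r0 : 0 <= r by exact: powR_ge0.
have r4 : r ^+ 4 = g by rewrite -powR_mulrn // -powRrM mulVf // powRr1.
have Mr : (weyl_maximal N x <= r%:E)%E.
  apply: ge_ereal_sup => _ [t /= + <-]; rewrite in_itv /= => tI.
  by rewrite lee_fin -(@ler_pXn2r R 4) ?nnegrE ?normc_ge0 // r4; exact: H.
have := weyl_maximal_ge0 N x; move: Mr; case: (weyl_maximal N x) => // m.
move=> mr m0; rewrite -EFin_expe lee_fin -r4; rewrite !lee_fin in mr m0.
by rewrite lerXn2r // nnegrE.
Qed.

End Integral.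

(** * The dyadic majorant *)

Section Majorant.
Variable R : realType.
Local Open Scope classical_set_scope.

(** The bound that [large_value] gives for the distance from [2 q x] to an integer
    at height [V = N / 2 ^ j]. *)
Definition arc_radius (N j : nat) : R := 2 ^+ 13 * (1 + ln N%:R) * 4 ^+ j / N%:R.

(** The constant covers the sums below the threshold of [large_value]; the term of
    index [j] is the fourth power of [2 N / 2 ^ j], supported on the arcs where
    [large_value] locates the sums of that size. *)
Definition majorant (N : nat) (x : R) : R :=
  2 ^+ 24 * (1 + ln N%:R) ^+ 2 * N%:R ^+ 2 +
  \sum_(j <- iota 0 (trunc_log 2 N).+1)
    \sum_(q <- index_iota 1 (8 * 4 ^ j).+1) \sum_(m <- index_iota 0 (2 * q).+1)
      16 * N%:R ^+ 4 / 16 ^+ j *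
      \1_(`[(m%:R - arc_radius N j) / (2 * q%:R), (m%:R + arc_radius N j) / (2 * q%:R)]) x.

Lemma le_sum_term (I : eqType) (r : seq I) (F : I -> R) (i : I) :
  (forall k, 0 <= F k) -> i \in r -> F i <= \sum_(k <- r) F k.
Proof. by move=> F0 ir; rewrite (big_rem i) //= lerDl sumr_ge0. Qed.

Lemma arc_radius_ge0 N j : 0 <= arc_radius N j.
Proof.
rewrite /arc_radius divr_ge0 // !mulr_ge0 ?exprn_ge0 //.
case: N => [|N]; first by rewrite ln0.
by rewrite addr_ge0 // ln_ge0 // ler1n.
Qed.

(** Rounding [N / s] up to a power of 2; that power is at most [N] because
    [2 <= s], so only logarithmically many scales occur. *)
Lemma dyadic_scale (N : nat) (s : R) : (0 < N)%N -> 2 <= s <= N%:R ->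
  exists j : nat, [/\ (j <= trunc_log 2 N)%N, N%:R <= s * 2 ^+ j & s * 2 ^+ j <= 2 * N%:R].
Proof.
move=> N0 /andP[s2 sN].
pose P j := N%:R <= s * 2 ^+ j.
have exP : exists j, P j.
  exists N; rewrite /P; have : N%:R <= 2 ^+ N :> R.
    by rewrite -natrX ler_nat ltnW // ltn_expl.
  by have : 0 <= 2 ^+ N :> R by []; nra.
case: (ex_minnP exP) => j Pj minj.
have up : s * 2 ^+ j <= 2 * N%:R.
  case: j Pj minj => [_ _|j _ minj]; first by rewrite expr0; lra.
  have : ~~ P j by apply/negP => /minj; rewrite ltnn.
  by rewrite /P -ltNge exprS => h; rewrite mulrCA ler_pM2l // ltW.
exists j; split=> //; apply: trunc_log_max => //.
rewrite -(ler_nat R) natrX; have : 0 <= 2 ^+ j :> R by [].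
nra.
Qed.

Lemma weyl_sum_pow4_le_majorant (N : nat) (x t : R) :
  (0 < N)%N -> 0 <= x <= 1 -> 0 < t < 1 ->
  normc (weyl_sum N x t) ^+ 4 <= majorant N x.
Proof.
move=> N0 xI /andP[t0 _]; set s := normc _; rewrite /majorant.
set L := 1 + ln _.
have s0 : 0 <= s by exact: normc_ge0.
have NR : 1 <= N%:R :> R by rewrite ler1n.
have L1 : 1 <= L by rewrite /L lerDl ln_ge0.
have sN : s <= N%:R := weyl_sum_le N x t.
have c0 : 0 <= 2 ^+ 24 * L ^+ 2 * N%:R ^+ 2 by rewrite !mulr_ge0 ?exprn_ge0 //; lra.
have term0 j q m : 0 <= 16 * N%:R ^+ 4 / 16 ^+ j *
      \1_(`[(m%:R - arc_radius N j) / (2 * q%:R), (m%:R + arc_radius N j) / (2 * q%:R)]) x :> R.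
  by rewrite mulr_ge0 // divr_ge0 ?mulr_ge0 ?exprn_ge0.
set T := (X in _ <= _ + X).
have T0 : 0 <= T by apply: sumr_ge0 => j _; apply: sumr_ge0 => q _; exact: sumr_ge0.
(* Four times the threshold of large_value, since V may be as small as s / 2. *)
have [h|h] := leP (s ^+ 2) (2 ^+ 12 * L * N%:R).
  apply: (@le_trans _ _ ((2 ^+ 12 * L * N%:R) ^+ 2)); last first.
    have -> : (2 ^+ 12 * L * N%:R) ^+ 2 = 2 ^+ 24 * L ^+ 2 * N%:R ^+ 2 by ring.
    by rewrite lerDl.
  by rewrite -[4%N]/(2 * 2)%N exprM lerXn2r // nnegrE ?sqr_ge0 // !mulr_ge0 //; lra.
have s2 : 2 <= s.
  rewrite leNgt; apply/negP => s2; have : s ^+ 2 <= 4 by rewrite expr2; nra.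
  have : 2 ^+ 12 <= 2 ^+ 12 * L * N%:R by nra.
  lra.
have [|j [jJ j1 j2]] := @dyadic_scale N s N0; first by rewrite s2.
pose p : R := 2 ^+ j; have p0 : 0 < p by rewrite exprn_gt0.
pose V := N%:R / p.
have VE : V * p = N%:R by rewrite divfK // gt_eqF.
have V0 : 0 < V by rewrite divr_gt0 //; lra.
have Vs : V <= s by rewrite ler_pdivrMr.
have sV : s <= 2 * V by rewrite -(ler_pM2r p0) -mulrA VE.
have VL : 2 ^+ 10 * L * N%:R <= V ^+ 2 by move: h; rewrite !expr2; nra.
have [q [m [q0 mq qV xq]]] := large_value N0 xI (ltW t0) V0 VL Vs.
have q0R : 0 < q%:R :> R by rewrite ltr0n.
have p2 : p ^+ 2 = 4 ^+ j.
  by rewrite /p -exprM mulnC exprM; congr (_ ^+ _); ring.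
have p4 : p ^+ 4 = 16 ^+ j.
  by rewrite /p -exprM mulnC exprM; congr (_ ^+ _); ring.
have N2 : N%:R ^+ 2 = V ^+ 2 * 4 ^+ j.
  by rewrite -VE exprMn p2.
have V20 : 0 < V ^+ 2 by rewrite exprn_gt0.
have q4 : (q <= 8 * 4 ^ j)%N.
  rewrite -(ler_nat R) natrM natrX -(ler_pM2r V20).
  by apply: le_trans qV _; rewrite N2; lra.
have xI' : `|2 * q%:R * x - m%:R| <= arc_radius N j.
  rewrite -(ler_pM2r V20); apply: le_trans xq _.
  rewrite /arc_radius -/L; have -> : 2 ^+ 13 * L * 4 ^+ j / N%:R * V ^+ 2 =
    2 ^+ 13 * L * N%:R ^+ 2 / N%:R by rewrite N2; ring.
  by rewrite expr2 mulrA mulfK // gt_eqF //; lra.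
have s4 : s ^+ 4 <= 16 * N%:R ^+ 4 / 16 ^+ j.
  have -> : 16 * N%:R ^+ 4 / 16 ^+ j = (2 * V) ^+ 4.
    by rewrite -VE -p4; field; rewrite gt_eqF.
  by rewrite lerXn2r // nnegrE // mulr_ge0 // ltW.
apply: (@le_trans _ _ T); last first.
  by rewrite lerDr.
apply: le_trans s4 _; rewrite /T.
apply: le_trans (le_sum_term (i := j) _ _); last first.
- by rewrite mem_iota add0n ltnS.
- by move=> i; apply: sumr_ge0 => ? _; exact: sumr_ge0.
apply: le_trans (le_sum_term (i := q) _ _); last first.
- by rewrite mem_index_iota q0 ltnS.
- by move=> i; exact: sumr_ge0.
apply: le_trans (le_sum_term (i := m) _ _); last first.
- by rewrite mem_index_iota ltnS.
- by move=> i; exact: term0.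
rewrite indicE mem_set ?mulr1 //= in_itv /=.
have q2 : 0 < 2 * q%:R :> R by rewrite mulr_gt0.
rewrite ler_pdivrMr // ler_pdivlMr // [x * _]mulrC.
by move: xI'; rewrite ler_norml => /andP[? ?]; apply/andP; split; lra.
Qed.

End Majorant.

Section MajorantIntegral.
Variable R : realType.
Local Open Scope classical_set_scope.

(** At scale [j] there are at most [8 * 4 ^ j] denominators, each with [2 q + 1]
    arcs of length [arc_radius / q], hence a total length of order
    [16 ^ j L / N]: the growth of the arcs cancels the decay of the heights, every
    scale contributes [O(L N ^ 3)], and there are at most [2 L] scales. *)
Lemma majorant_integral_bound (N : nat) : (0 < N)%N ->
  exists2 v, integral_bound (@majorant R N) v &
   v <= 2 ^+ 25 * (1 + ln N%:R) ^+ 2 * N%:R ^+ 3.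
Proof.
move=> N0; set L := 1 + ln _.
have NR : 1 <= N%:R :> R by rewrite ler1n.
have L1 : 1 <= L by rewrite /L lerDl ln_ge0.
(* The value v is read off from the shape of the majorant. *)
eexists.
  apply: integral_boundD.
    by apply: integral_bound_cst; rewrite -/L !mulr_ge0 ?exprn_ge0 //; lra.
  apply: integral_bound_sum => j; apply: integral_bound_sum => q.
  apply: integral_bound_sum => m; apply: integral_bound_indic.
    by rewrite divr_ge0 ?mulr_ge0 ?exprn_ge0.
  rewrite ler_wpM2r ?invr_ge0 ?mulr_ge0 // lerD2l.
  by apply: le_trans (arc_radius_ge0 R N j); rewrite oppr_le0 arc_radius_ge0.
rewrite -/L.
have inner j q : (0 < q)%N -> \sum_(m <- index_iota 0 (2 * q).+1)
   16 * N%:R ^+ 4 / 16 ^+ j *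
   ((m%:R + arc_radius R N j) / (2 * q%:R) - (m%:R - arc_radius R N j) / (2 * q%:R))
   <= 16 * N%:R ^+ 4 / 16 ^+ j * (3 * arc_radius R N j) :> R.
  move=> q0; have q0R : 1 <= q%:R :> R by rewrite ler1n.
  under eq_bigr => m _.
    have -> : (m%:R + arc_radius R N j) / (2 * q%:R) - (m%:R - arc_radius R N j) / (2 * q%:R)
      = arc_radius R N j / q%:R by field; rewrite gt_eqF //; lra.
    over.
  rewrite sumr_const_nat subn0 -[leLHS]mulr_natr -mulrA.
  rewrite ler_wpM2l ?divr_ge0 ?mulr_ge0 ?exprn_ge0 //.
  rewrite mulrAC ler_pdivrMr; last lra.
  by rewrite -natr1 natrM; have := @arc_radius_ge0 R N j; nra.
have middle j : \sum_(q <- index_iota 1 (8 * 4 ^ j).+1)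
   \sum_(m <- index_iota 0 (2 * q).+1) 16 * N%:R ^+ 4 / 16 ^+ j *
   ((m%:R + arc_radius R N j) / (2 * q%:R) - (m%:R - arc_radius R N j) / (2 * q%:R))
   <= 3 * 2 ^+ 20 * L * N%:R ^+ 3 :> R.
  apply: (@le_trans _ _ (\sum_(1 <= q < (8 * 4 ^ j).+1)
      16 * N%:R ^+ 4 / 16 ^+ j * (3 * arc_radius R N j))).
    rewrite big_nat [leRHS]big_nat; apply: ler_sum => q /andP[q0 _]; exact: inner.
  rewrite sumr_const_nat subn1 /= -[leLHS]mulr_natr natrM natrX /arc_radius -/L.
  have -> : 16 ^+ j = 4 ^+ j * 4 ^+ j :> R by rewrite -exprMn -natrM.
  rewrite le_eqVlt; apply/orP; left; apply/eqP; field.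
  by rewrite expf_neq0 //= gt_eqF //; lra.
have JL : (trunc_log 2 N).+1%:R <= 2 * L :> R.
  rewrite -natr1; set J := trunc_log 2 N.
  have : ln (2 ^+ J) <= ln N%:R :> R.
    rewrite ler_ln ?posrE ?exprn_gt0 // ?ltr0n //.
    by rewrite -natrX ler_nat trunc_logP.
  rewrite lnXn // -[ln 2 *+ _]mulr_natr.
  have : 1 / 2 <= ln 2 :> R.
    have := @le_ln1Dx R (- (1 / 2)).
    have -> : 1 + - (1 / 2) = 2^-1 :> R by field.
    rewrite lnV ?posrE //; lra.
  have : 0 <= J%:R :> R by [].
  rewrite /L; nra.
apply: (@le_trans _ _ (2 ^+ 24 * L ^+ 2 * N%:R ^+ 2 +
    2 * L * (3 * 2 ^+ 20 * L * N%:R ^+ 3))).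
  rewrite lerD2l.
  apply: (@le_trans _ _ (\sum_(0 <= j < (trunc_log 2 N).+1)
     3 * 2 ^+ 20 * L * N%:R ^+ 3)).
    by rewrite /index_iota subn0; apply: ler_sum => j _; exact: middle.
  rewrite sumr_const_nat subn0 -[leLHS]mulr_natl ler_wpM2r //.
  by rewrite !mulr_ge0 ?exprn_ge0 //; lra.
have -> : 2 ^+ 25 * L ^+ 2 * N%:R ^+ 3 = 2 ^+ 24 * (L ^+ 2 * N%:R ^+ 3) +
  2 ^+ 24 * (L ^+ 2 * N%:R ^+ 3) by ring.
apply: lerD.
  rewrite -mulrA ler_pM2l ?exprn_gt0 // ler_wpM2l ?exprn_ge0 //; first lra.
  by rewrite ler_weXn2l.
have -> : 2 * L * (3 * 2 ^+ 20 * L * N%:R ^+ 3) = (6 * 2 ^+ 20) * (L ^+ 2 * N%:R ^+ 3).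
  by ring.
rewrite ler_wpM2r //; last lra.
by rewrite mulr_ge0 // exprn_ge0 //; lra.
Qed.

(** A logarithm is below any power: [2 eps ln N = ln (N `^ (2 eps))]. *)
Lemma log_sqr_le (eps : R) : 0 < eps -> exists2 K, 1 <= K &
  forall N : nat, (0 < N)%N -> (1 + ln N%:R) ^+ 2 <= K * N%:R `^ eps ^+ 4.
Proof.
move=> e0; exists ((1 + (2 * eps)^-1) ^+ 2).
  by rewrite expr_ge1 // ?lerDl ?addr_ge0 // invr_ge0 mulr_ge0 // ltW.
move=> N N0; have NR : 1 <= N%:R :> R by rewrite ler1n.
have -> : N%:R `^ eps ^+ 4 = (N%:R `^ (2 * eps)) ^+ 2 :> R.
  by rewrite -[4%N]/(2 * 2)%N exprM mulrC powRrM powR_mulrn ?powR_ge0.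
set P := _ `^ (2 * eps).
have P1 : 1 <= P.
  by rewrite -(powRr0 N%:R); apply: ler_powR => //; rewrite mulr_ge0 // ltW.
have lnP : 2 * eps * ln N%:R <= P.
  by rewrite -ln_powR -/P ltW // ln_sublinear // (lt_le_trans ltr01 P1).
have ln0 : 0 <= ln N%:R :> R by rewrite ln_ge0.
have h : ln N%:R <= (2 * eps)^-1 * P.
  by rewrite mulrC ler_pdivlMr ?mulr_gt0 // mulrC.
rewrite -exprMn lerXn2r // ?nnegrE; last by rewrite mulrDl mul1r; lra.
- by rewrite addr_ge0.
- by rewrite mulr_ge0 ?addr_ge0 ?invr_ge0 ?mulr_ge0 //; lra.
Qed.

End MajorantIntegral.

(** * The maximal inequality *)

Theorem theorem1p1 (R : realType) (eps : R) (heps : 0 < eps) :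
  exists C : R, 0 < C /\
    forall N : nat, (1 <= N)%N ->
      ((\int[@lebesgue_measure R]_(x in `[0%R, 1%R]%classic)
          (weyl_maximal N x) ^+ 4) `^ (4^-1)%R
       <= (C * N%:R `^ (3 / 4 + eps))%:E)%E.
Proof.
have [K K1 HK] := log_sqr_le heps.
(* The constant is used to the fourth power, which is harmless as it is at least 1. *)
pose C : R := 2 ^+ 25 * K.
have C1 : 1 <= C.
  have h : 1 <= 2 ^+ 25 :> R by rewrite exprn_ege1 // ler1n.
  by rewrite /C; nra.
exists C; split=> [|N N0]; first lra.
have [v vbound v_le] := @majorant_integral_bound R N N0.
set P := N%:R `^ (3 / 4 + eps).
have N0R : N%:R != 0 :> R by rewrite pnatr_eq0 -lt0n.
have P0 : 0 <= P by exact: powR_ge0.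
have P4 : P ^+ 4 = N%:R ^+ 3 * N%:R `^ eps ^+ 4.
  rewrite /P powRD ?N0R ?implybT // exprMn; congr (_ * _).
  rewrite -[LHS]powR_mulrn ?powR_ge0 // -powRrM divfK // powR_mulrn //.
have vB : v <= (C * P) ^+ 4.
  apply: le_trans v_le _; rewrite exprMn P4.
  apply: (@le_trans _ _ (C * (N%:R ^+ 3 * N%:R `^ eps ^+ 4))); last first.
    rewrite ler_wpM2r ?mulr_ge0 ?exprn_ge0 ?powR_ge0 //.
    by rewrite -[leLHS]expr1 ler_weXn2l.
  have -> : C * (N%:R ^+ 3 * N%:R `^ eps ^+ 4) =
    2 ^+ 25 * (K * N%:R `^ eps ^+ 4) * N%:R ^+ 3 by rewrite /C; ring.
  by rewrite ler_wpM2r ?exprn_ge0 // ler_pM2l ?HK //.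
have CP0 : 0 <= C * P by rewrite mulr_ge0 //; lra.
have M0 (x : R) : (0 <= weyl_maximal N x ^+ 4)%E by rewrite expe_ge0 // weyl_maximal_ge0.
have int_le : (\int[@lebesgue_measure R]_(x in `[0%R, 1%R]%classic)
    (weyl_maximal N x) ^+ 4 <= ((C * P) ^+ 4)%:E)%E.
  apply: (@le_trans _ _ v%:E); last by rewrite lee_fin.
  apply: (integral_le_of_majorant M0 vbound) => x xI.
  apply: weyl_maximal_pow4_le; first by case: vbound.
  by move=> t tI; exact: weyl_sum_pow4_le_majorant.
have -> : C * P = ((C * P) ^+ 4) `^ 4^-1.
  by rewrite -powR_mulrn // -powRrM mulfV // powRr1.
rewrite -poweR_EFin; apply: gt0_ler_poweR => //.
- by rewrite in_itv /= leey andbT; apply: integral_ge0 => x _; exact: M0.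
- by rewrite in_itv /= leey andbT lee_fin exprn_ge0.
Qed.
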